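(* Let $\Lambda\subseteq\mathbb{R}$ be not contained in an arithmetic progression, and let $U=\{u_j : j\in\mathbb{N}\}\subseteq\mathbb{R}_+$ be a sequence satisfying $$\sum_{\substack{j=1\\ u_j\neq 0}}^\infty \frac{1}{u_j}=\infty.$$ Then $-U\times\Lambda$ is a uniqueness set for the Gabor phase retrieval problem in $L^2(\mathbb{R}_+)$.
   Context: An arithmetic progression is a set of the form $a\mathbb{Z}+b$ with $a,b\in\mathbb{R}$ (the choice $a=0$ is allowed). $\mathbb{R}_+=[0,\infty)$, and $L^2(\mathbb{R}_+)$ is regarded as the subspace of (complex-valued) functions in $L^2(\mathbb{R})$ vanishing almost everywhere outside $\mathbb{R}_+$. The set $-U\times\Lambda$ is $\{(-u,\lambda): u\in U,\ \lambda\in\Lambda\}\subseteq\mathbb{R}^2$. With $\varphi(t)=e^{-\pi t^2}$, the Gabor transform of $f\in L^2(\mathbb{R})$ is $\mathcal{G}f(x,\omega)=\int_{\mathbb{R}} f(t)\varphi(t-x)e^{-2\pi i\omega t}\,dt$ for $(x,\omega)\in\mathbb{R}^2$. Write $f\sim h$ if there is $\tau\in\mathbb{C}$, $|\tau|=1$, with $f=\tau h$. A set $\mathcal{U}\subseteq\mathbb{R}^2$ is a uniqueness set for the Gabor phase retrieval problem in $X\subseteq L^2(\mathbb{R})$ if for all $f,h\in X$: $|\mathcal{G}f(z)|=|\mathcal{G}h(z)|$ for all $z\in\mathcal{U}$ implies $f\sim h$.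
   Formalization: The formal theorem assumes that the u_j are pairwise distinct; with repetitions allowed the claim fails (u_j = 1 for all j, so U = {1}, with Λ = ℝ: reflecting f(t)φ(t+1) on [0,1] gives the same moduli). *)

(* Defs.v *)
From HB Require Import structures.
From mathcomp Require Import all_boot all_order all_algebra.
From mathcomp Require Import complex.
From mathcomp Require Import all_classical all_reals all_analysis.

Set Implicit Arguments.
Unset Strict Implicit.
Unset Printing Implicit Defensive.

Import Order.TTheory GRing.Theory Num.Theory.
Import numFieldNormedType.Exports.

Local Open Scope classical_set_scope.
Local Open Scope ring_scope.
Local Open Scope complex_scope.

Definition arith_prog (R : realType) (a b : R) : set R :=
  [set a * k%:~R + b | k in [set: int]].

(* The Lebesgue integral of a complex-valued function, componentwise; it is
   meaningful when both components are integrable. *)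
Definition Cintegral (R : realType) (g : R -> R[i]) : R[i] :=
  (\int[lebesgue_measure]_(t in [set: R]) complex.Re (g t)) +i*
  (\int[lebesgue_measure]_(t in [set: R]) complex.Im (g t)).

(* L^2(R; C) as a set of Borel representatives (every Lebesgue a.e. class
   contains one), compared only up to null sets in [eq_upto_phase]. *)
Definition L2 (R : realType) : set (R -> R[i]) :=
  [set f : R -> R[i] | [/\ measurable_fun [set: R] (fun t : R => complex.Re (f t)),
               measurable_fun [set: R] (fun t : R => complex.Im (f t)) &
               (\int[lebesgue_measure]_(t in [set: R])
                  (ComplexField.Normc.normc (f t) ^+ 2)%:E < +oo)%E]].

Definition L2_Rplus (R : realType) : set (R -> R[i]) :=
  [set f : R -> R[i] | L2 f /\ {ae lebesgue_measure, forall t : R, ~ 0 <= t -> f t = 0}].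

Definition gaussian (R : realType) (t : R) : R := expR (- (pi * t ^+ 2)).

(* exp(i y) *)
Definition expi (R : realType) (y : R) : R[i] := cos y +i* sin y.

Definition gabor (R : realType) (f : R -> R[i]) (z : R * R) : R[i] :=
  Cintegral (fun t =>
    f t * (gaussian (t - z.1))%:C * expi (- (2 * pi * z.2 * t))).

Definition eq_upto_phase (R : realType) (f h : R -> R[i]) : Prop :=
  exists2 tau : R[i], `|tau| = 1 &
    {ae lebesgue_measure, forall t : R, f t = tau * h t}.

Definition gabor_uniqueness_set (R : realType)
    (X : set (R -> R[i])) (V : set (R * R)) : Prop :=
  forall f h : R -> R[i], X f -> X h ->
    (forall z, V z -> `|gabor f z| = `|gabor h z|) -> eq_upto_phase f h.

(* Main.v *)
Require Import Defs.
From mathcomp Require Import all_boot all_order all_algebra.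
From mathcomp Require Import complex.
From mathcomp Require Import all_classical all_reals all_analysis measurable_realfun.
From mathcomp Require Import ring lra.

Import Order.TTheory GRing.Theory Num.Theory.
Import numFieldNormedType.Exports.

Local Open Scope classical_set_scope.
Local Open Scope ring_scope.

(** Up to a Gaussian factor, the Gabor transform of [f] at [(- u, l)] is the
    Laplace transform of [f] times a Gaussian at [2 pi (u + i l)], an entire
    function [F] bounded on every right half plane; let [H] be the one of [h]
    and write F#(z) for the conjugate of F(conj z).  On the line of imaginary
    part m = 2 pi l the hypothesis says that the function
    F(z + i m) F#(z - i m) - H(z + i m) H#(z - i m) vanishes at the points
    2 pi u_j, so by Müntz' theorem it vanishes identically.  Dividing these
    identities for two values of [l], F#/H# has all the periods
    4 pi i (l - l'); as [Lambda] is in no arithmetic progression, the periods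
    include arbitrarily small ones, F#/H# is constant, and F = tau H with |tau| = 1.
    Injectivity of the Laplace transform concludes. *)

(** * Exponential sums and the algebra of [exp_bounded] functions *)

Section ExponentialSums.
Set Implicit Arguments.
Unset Strict Implicit.
Unset Printing Implicit Defensive.
Import ComplexField.Normc.
Local Open Scope complex_scope.
Variable R : realType.
Implicit Types (z w q : R[i]) (s : seq (R[i] * R[i])) (t : R).

Definition cexp z : R[i] := (expR (complex.Re z))%:C * expi (complex.Im z).

Lemma cexp0 : cexp 0 = 1.
Proof. by rewrite /cexp /expi /= expR0 cos0 sin0 mul1r. Qed.

Lemma expiD (x y : R) : expi (x + y) = expi x * expi y.
Proof.
rewrite /expi cosD sinD; apply/eqP; rewrite eq_complex /=.
by apply/andP; split; apply/eqP => //; ring.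
Qed.

Lemma cexpD z w : cexp (z + w) = cexp z * cexp w.
Proof.
by rewrite /cexp !raddfD /= expRD expiD rmorphM mulrACA.
Qed.

Lemma normc_real (x : R) : normc x%:C = `|x|.
Proof. by rewrite /normc /= expr0n /= addr0 sqrtr_sqr. Qed.

Lemma normc_ge0 z : 0 <= normc z.
Proof. by case: z => a b; exact: sqrtr_ge0. Qed.

Lemma normc_eq0 z : (normc z == 0) = (z == 0).
Proof. by apply/eqP/eqP => [/eq0_normc //|->]; rewrite normc0. Qed.

Lemma normc_gt0 z : (0 < normc z) = (z != 0).
Proof. by rewrite lt_neqAle normc_ge0 andbT eq_sym normc_eq0. Qed.

Lemma norm_normc z : `|z| = (normc z)%:C.
Proof. by rewrite normc_def; case: z. Qed.

Lemma normc_conj z : normc z^* = normc z.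
Proof. by case: z => a b; rewrite /normc /= sqrrN. Qed.

Lemma Re_le_normc z : complex.Re z <= normc z.
Proof.
apply: le_trans (ler_norm _) _.
by have := normc_ge_Re z; rewrite norm_normc lecR.
Qed.

Lemma norm_Re_le z : `|complex.Re z| <= normc z.
Proof. by have := normc_ge_Re z; rewrite norm_normc lecR. Qed.

Lemma norm_Im_le z : `|complex.Im z| <= normc z.
Proof.
case: z => a b /=; rewrite -sqrtr_sqr ler_wsqrtr // lerDr.
exact: sqr_ge0.
Qed.

Lemma normc_le_ReIm z : normc z <= `|complex.Re z| + `|complex.Im z|.
Proof.
have -> : z = (complex.Re z)%:C + (0 +i* 1) * (complex.Im z)%:C.
  case: z => a b; apply/eqP; rewrite eq_complex /=.
  by rewrite !(mul0r, mul1r, mulr0, subr0, addr0, add0r) !eqxx.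
apply: le_trans (le_normcD _ _) _.
rewrite normcM !normc_real /= !(mul0r, mul1r, mulr0, subr0, addr0, add0r).
by rewrite expr0n expr1n add0r sqrtr1 mul1r.
Qed.

Lemma normc_expi (x : R) : normc (expi x) = 1.
Proof. by rewrite /normc /expi cos2Dsin2 sqrtr1. Qed.

Lemma normc_cexp z : normc (cexp z) = expR (complex.Re z).
Proof. by rewrite normcM normc_real normc_expi mulr1 ger0_norm // expR_ge0. Qed.

Lemma cexp_conj z : cexp z^* = (cexp z)^*.
Proof.
case: z => a b; apply/eqP.
by rewrite eq_complex /cexp /expi /= cosN sinN !(mul0r, addr0, subr0) mulrN !eqxx.
Qed.

Lemma cexpMreal_conj z t : cexp (- (z^* * t%:C)) = (cexp (- (z * t%:C)))^*.
Proof. by rewrite -cexp_conj rmorphN rmorphM; congr (cexp (- (_ * _))); rewrite /= oppr0. Qed.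

(** A pair is a coefficient and a decay exponent, and exponents may repeat. For [Phi] in the class
    [exp_bounded], the bound with B = 0 makes [evalsum Phi s] depend only on the function [expsum s]
    on t >= 0. *)
Definition expsum s t : R[i] := \sum_(p <- s) p.1 * cexp (- (p.2 * t%:C)).

Definition evalsum (Phi : R[i] -> R[i]) s : R[i] := \sum_(p <- s) p.1 * Phi p.2.

(* The entire functions [Phi] that extend, for every [M], to a functional on
   exponential sums which is bounded for the norm sup_(t >= 0) e^(-M t) |.|;
   the functional maps [t |-> e^(- z t)] to [Phi z].  Laplace transforms of
   rapidly decaying functions on the half line are of this kind, and unlike
   these the class is visibly closed under products. *)
Definition exp_bounded (Phi : R[i] -> R[i]) : Prop :=
  forall M : R, exists2 K : R, 0 <= K & forall s (B : R),
    (forall t, 0 <= t -> normc (expsum s t) <= B * expR (M * t)) ->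
    normc (evalsum Phi s) <= K * B.

Lemma exp_bounded_add Phi Psi : exp_bounded Phi -> exp_bounded Psi ->
  exp_bounded (fun z => Phi z + Psi z).
Proof.
move=> hPhi hPsi M; have [K K0 hK] := hPhi M; have [L L0 hL] := hPsi M.
exists (K + L); first exact: addr_ge0.
move=> s B hB; rewrite /evalsum.
under eq_bigr do rewrite mulrDr.
rewrite big_split /= mulrDl; apply: le_trans (le_normcD _ _) _.
by apply: lerD; [exact: hK|exact: hL].
Qed.

(** As e^(- z (t + r)) = e^(- z t) e^(- z r), the functional of the product is the convolution of
    the two: apply that of [Psi] in r, then that of [Phi] in t, to [expsum s (t + r)]. The weight
    e^(M (t + r)) splits in the same way. *)
Lemma exp_bounded_mul Phi Psi : exp_bounded Phi -> exp_bounded Psi ->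
  exp_bounded (fun z => Phi z * Psi z).
Proof.
move=> hPhi hPsi M; have [K K0 hK] := hPhi M; have [L L0 hL] := hPsi M.
exists (K * L); first exact: mulr_ge0.
move=> s B hB.
pose s' := [seq (p.1 * Psi p.2, p.2) | p <- s].
have -> : evalsum (fun z => Phi z * Psi z) s = evalsum Phi s'.
  rewrite /evalsum big_map; apply: eq_bigr => p _ /=.
  by rewrite mulrA mulrAC.
rewrite -mulrA; apply: hK => t t0.
pose s'' := [seq (p.1 * cexp (- (p.2 * t%:C)), p.2) | p <- s].
have -> : expsum s' t = evalsum Psi s''.
  by rewrite /expsum /evalsum !big_map; apply: eq_bigr => p _ /=; rewrite mulrAC.
rewrite -mulrA; apply: hL => r r0.
have -> : expsum s'' r = expsum s (t + r).
  rewrite /expsum big_map; apply: eq_bigr => p _ /=.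
  by rewrite rmorphD mulrDr opprD cexpD mulrA.
by rewrite -mulrA -expRD -mulrDr; apply: hB; exact: addr_ge0.
Qed.

Lemma exp_bounded_scale c Phi : exp_bounded Phi ->
  exp_bounded (fun z => c * Phi z).
Proof.
move=> hPhi M; have [K K0 hK] := hPhi M.
exists (normc c * K); first by apply: mulr_ge0 => //; exact: normc_ge0.
move=> s B hB; have -> : evalsum (fun z => c * Phi z) s = c * evalsum Phi s.
  by rewrite /evalsum mulr_sumr; apply: eq_bigr => p _; rewrite mulrCA.
by rewrite normcM -mulrA ler_wpM2l ?normc_ge0 //; exact: hK.
Qed.

Lemma exp_bounded_sub Phi Psi : exp_bounded Phi -> exp_bounded Psi ->
  exp_bounded (fun z => Phi z - Psi z).
Proof.
move=> hPhi /(exp_bounded_scale (-1)) hPsi.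
have := exp_bounded_add hPhi hPsi.
by congr exp_bounded; apply/funext => z; rewrite mulN1r.
Qed.

(** Moving all exponents by w multiplies the sum by e^(- w t), which only changes the weight from M
    to M - Re w. *)
Lemma exp_bounded_shift w Phi : exp_bounded Phi ->
  exp_bounded (fun z => Phi (z + w)).
Proof.
move=> hPhi M; have [K K0 hK] := hPhi (M - complex.Re w).
exists K => // s B hB.
pose s' := [seq (p.1, p.2 + w) | p <- s].
have -> : evalsum (fun z => Phi (z + w)) s = evalsum Phi s'.
  by rewrite /evalsum big_map.
apply: hK => t t0.
have -> : expsum s' t = cexp (- (w * t%:C)) * expsum s t.
  rewrite /expsum big_map mulr_sumr; apply: eq_bigr => p _ /=.
  by rewrite mulrDl opprD cexpD [LHS]mulrA [LHS]mulrC.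
have -> : expR ((M - complex.Re w) * t) = expR (- (complex.Re w * t)) * expR (M * t).
  by rewrite -expRD mulrBl addrC.
have hre : complex.Re (- (w * t%:C)) = - (complex.Re w * t).
  by case: (w) => a b /=; rewrite mulr0 subr0.
rewrite normcM normc_cexp hre [leRHS]mulrCA.
by apply: ler_wpM2l; [exact: expR_ge0|exact: hB].
Qed.

(** For real t, conjugating coefficients and exponents conjugates the sum. *)
Lemma exp_bounded_conj Phi : exp_bounded Phi ->
  exp_bounded (fun z => (Phi z^*)^*).
Proof.
move=> hPhi M; have [K K0 hK] := hPhi M.
exists K => // s B hB.
pose s' := [seq (p.1^*, p.2^*) | p <- s].
have -> : evalsum (fun z => (Phi z^*)^*) s = (evalsum Phi s')^*.
  rewrite /evalsum big_map rmorph_sum; apply: eq_bigr => p _ /=.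
  by rewrite rmorphM /= conjcK.
rewrite normc_conj; apply: hK => t t0.
have -> : expsum s' t = (expsum s t)^*.
  rewrite /expsum big_map rmorph_sum; apply: eq_bigr => p _ /=.
  by rewrite rmorphM cexpMreal_conj.
by rewrite normc_conj; exact: hB.
Qed.

End ExponentialSums.

(** * Derivatives and primitives of exponential sums *)

Section Muentz.
Set Implicit Arguments.
Unset Strict Implicit.
Unset Printing Implicit Defensive.
Import ComplexField.Normc.
Local Open Scope complex_scope.
Variable R : realType.
Implicit Types (z w q c l mu : R[i]) (s : seq (R[i] * R[i])) (t : R).

(** Only real parts are differentiated, because the mean value theorem used below is real. *)
Lemma is_derive_Re_cexp c mu t :
  is_derive t 1 (fun r => complex.Re (c * cexp (mu * r%:C)))
    (complex.Re (c * mu * cexp (mu * t%:C))).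
Proof.
case: c => a b; case: mu => x y.
pose f r := expR (x * r) * (a * cos (y * r) - b * sin (y * r)).
have -> : (fun r => complex.Re ((a +i* b) * cexp ((x +i* y) * r%:C))) = f.
  by apply/funext => r; rewrite /f /= !(mulr0, mul0r, addr0, subr0, add0r); ring.
have dx : is_derive t 1 (fun r : R => x * r) x.
  by apply: is_derive_eq; rewrite /GRing.scale /= mulr1.
have dy : is_derive t 1 (fun r : R => y * r) y.
  by apply: is_derive_eq; rewrite /GRing.scale /= mulr1.
have dE := @is_derive1_comp R expR (fun r : R => x * r) t _ _ (is_derive_expR _) dx.
have dC := @is_derive1_comp R cos (fun r : R => y * r) t _ _ (is_derive_cos _) dy.
have dS := @is_derive1_comp R sin (fun r : R => y * r) t _ _ (is_derive_sin _) dy.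
have -> : f = (expR \o (fun r : R => x * r)) *
  (a *: (cos \o (fun r : R => y * r)) - b *: (sin \o (fun r : R => y * r))).
  by apply/funext => r.
apply: is_derive_eq.
rewrite /GRing.scale /= !(mulr0, mul0r, addr0, subr0, add0r).
rewrite !fctE /= -[a *: _]/(a * _) -[b *: _]/(b * _); ring.
Qed.

Lemma is_derive_Re_sum s t :
  is_derive t 1 (fun r => complex.Re (\sum_(p <- s) p.1 * cexp (p.2 * r%:C)))
    (complex.Re (\sum_(p <- s) p.1 * p.2 * cexp (p.2 * t%:C))).
Proof.
elim: s => [|p s ih].
  under eq_fun do rewrite big_nil.
  by rewrite big_nil; exact: is_derive_cst.
under eq_fun do rewrite big_cons raddfD.
rewrite big_cons raddfD /=; apply: is_deriveD; exact: is_derive_Re_cexp.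
Qed.


Lemma le_of_derive_ge0 (g dg : R -> R) t : 0 <= t ->
  (forall r : R, is_derive r 1 g (dg r)) -> (forall r, 0 <= r -> 0 <= dg r) ->
  g 0 <= g t.
Proof.
move=> t0 hg dg0; have [|c] := @MVT_segment R g dg 0 t t0 (fun r _ => hg r).
  apply: derivable_within_continuous => r _.
  by have [] := hg r.
rewrite in_itv /= => /andP[c0 _] e.
by rewrite -subr_ge0 e mulr_ge0 ?subr0 // dg0.
Qed.

(** The rotation by conj z / |z| carries z to |z|. *)
Lemma normc_le_of_Re (z : R[i]) (B : R) :
  (forall th : R[i], normc th = 1 -> complex.Re (th * z) <= B) -> normc z <= B.
Proof.
have [->|z0] := eqVneq z 0 => h.
  by have := h 1 (normc1 _); rewrite mulr0 normc0.
have n0 : normc z != 0 by rewrite normc_eq0.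
have := h (z^* / (normc z)%:C) _.
have -> : z^* / (normc z)%:C * z = (normc z)%:C.
  rewrite mulrAC [_^* * _]mulrC -sqr_normc norm_normc expr2 mulfK //.
  by rewrite eq_complex /= negb_and n0.
apply.
by rewrite normcM normc_conj -fmorphV normc_real ger0_norm ?invr_ge0 ?normc_ge0 // divff.
Qed.

(* The bounded sum is [e^(- l t)] times the integral of [e^(l r) expsum s r]
   over [0, t]. *)
Lemma normc_expsum_primitive s l (B : R) : 0 < complex.Re l ->
  all (fun p => p.2 != l) s ->
  (forall t, 0 <= t -> normc (expsum s t) <= B) ->
  forall t, 0 <= t ->
    normc (\sum_(p <- s) p.1 / (l - p.2) *
            (cexp (- (p.2 * t%:C)) - cexp (- (l * t%:C)))) <= B / complex.Re l.
Proof.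
move=> l0 /allP sl hB t t0.
have B0 : 0 <= B := le_trans (normc_ge0 _) (hB 0 (lexx _)).
pose T r : R[i] := \sum_(p <- s) p.1 / (l - p.2) * (cexp ((l - p.2) * r%:C) - 1).
have -> : \sum_(p <- s) p.1 / (l - p.2) *
   (cexp (- (p.2 * t%:C)) - cexp (- (l * t%:C))) = cexp (- (l * t%:C)) * T t.
  rewrite /T mulr_sumr; apply: eq_bigr => p _.
  rewrite mulrCA; congr (_ * _).
  by rewrite mulrBr mulr1 -cexpD mulrBl addrA addNr add0r.
have Rel r : complex.Re (l * r%:C) = complex.Re l * r.
  by case: (l) => a b /=; rewrite mulr0 subr0.
have ReNl r : complex.Re (- (l * r%:C)) = - (complex.Re l * r).
  by rewrite -Rel; case: (l * _).
suff h : normc (T t) <= B / complex.Re l * expR (complex.Re l * t).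
  rewrite normcM normc_cexp ReNl mulrC.
  apply: le_trans (_ : _ <= B / complex.Re l * expR (complex.Re l * t) *
                            expR (- (complex.Re l * t))) _.
    by apply: ler_wpM2r h; exact: expR_ge0.
  by rewrite -mulrA -expRD subrr expR0 mulr1.
apply: normc_le_of_Re => th th1.
pose s' := [seq (th * (p.1 / (l - p.2)), l - p.2) | p <- s].
pose k := complex.Re (th * \sum_(p <- s) p.1 / (l - p.2)).
have TE r : complex.Re (th * T r) = complex.Re (\sum_(p <- s') p.1 * cexp (p.2 * r%:C)) - k.
  rewrite /k -raddfB; congr complex.Re.
  rewrite big_map !mulr_sumr -sumrB; apply: eq_bigr => p _ /=.
  by rewrite mulrBr mulr1 mulrBr mulrA.
(* The derivative of [g] is B e^(Re l r) minus the real part of th e^(l r) [expsum s r], hence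
   nonnegative for r >= 0. The inequality g 0 <= g t is then the wanted bound up to the nonnegative
   term B / Re l. *)
pose g r := B / complex.Re l * expR (complex.Re l * r) -
   complex.Re (\sum_(p <- s') p.1 * cexp (p.2 * r%:C)).
have dg (r : R) : is_derive r 1 g (B * expR (complex.Re l * r) -
   complex.Re (\sum_(p <- s') p.1 * p.2 * cexp (p.2 * r%:C))).
  have dx : is_derive r 1 (fun r : R => complex.Re l * r) (complex.Re l).
    by apply: is_derive_eq; rewrite /GRing.scale /= mulr1.
  have dE := @is_derive1_comp R expR (fun r : R => complex.Re l * r) r _ _ (is_derive_expR _) dx.
  have dS := is_derive_Re_sum s' r.
  have -> : g = (B / complex.Re l) *: (expR \o (fun r : R => complex.Re l * r)) -
    (fun r => complex.Re (\sum_(p <- s') p.1 * cexp (p.2 * r%:C))).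
    by apply/funext.
  apply: is_derive_eq; rewrite /GRing.scale /=.
  by congr (_ - _); field; rewrite gt_eqF.
have := @le_of_derive_ge0 g _ t t0 dg _.
have T0 : complex.Re (th * T 0) = 0.
  rewrite /T big1 ?mulr0 // => p _.
  by rewrite mulr0 cexp0 subrr mulr0.
have := TE 0; rewrite T0 /g TE => /eqP; rewrite eq_sym subr_eq0 => /eqP ->.
rewrite mulr0 expR0 mulr1 => h.
have : B / complex.Re l - k <= B / complex.Re l * expR (complex.Re l * t) -
    complex.Re (\sum_(p <- s') p.1 * cexp (p.2 * t%:C)).
  apply: h => r r0; rewrite subr_ge0.
  have -> : \sum_(p <- s') p.1 * p.2 * cexp (p.2 * r%:C) =
     th * (cexp (l * r%:C) * expsum s r).
    rewrite /expsum big_map !mulr_sumr !big_seq; apply: eq_bigr => p ps /=.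
    have lp : l - p.2 != 0 by rewrite subr_eq0 eq_sym sl.
    rewrite [cexp (l * _) * _]mulrCA -cexpD -mulrBl.
    by rewrite -[th * _ * (l - p.2)]mulrA divfK // -mulrA.
  apply: le_trans (Re_le_normc _) _.
  rewrite normcM th1 mul1r normcM normc_cexp Rel mulrC.
  by apply: ler_wpM2r; [exact: expR_ge0|exact: hB].
have : 0 <= B / complex.Re l by rewrite divr_ge0 // ltW.
lra.
Qed.

End Muentz.

(** * Müntz approximation and the zeros of [exp_bounded] functions *)

Section Uniqueness.
Set Implicit Arguments.
Unset Strict Implicit.
Unset Printing Implicit Defensive.
Import ComplexField.Normc.
Local Open Scope complex_scope.
Variable R : realType.
Implicit Types (z w q c l mu : R[i]) (s : seq (R[i] * R[i])) (t : R).

(* Von Golitschek's proof of Müntz' theorem: each exponent [z] is adjoined by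
   solving P' + z P = (z - q) P_old with P(0) = 0. *)
Lemma muentz_approx q (zs : seq R[i]) : 0 <= complex.Re q -> uniq zs ->
  {in zs, forall z, z != q /\ 0 < complex.Re z} ->
  exists2 s, all (fun p => p.2 \in zs) s & forall t, 0 <= t ->
    normc (cexp (- (q * t%:C)) + expsum s t) <=
      \prod_(z <- zs) (normc (z - q) / complex.Re z).
Proof.
move=> q0; elim: zs => [|z zs ih] /=.
  move=> _ _; exists [::] => // t t0.
  rewrite /expsum !big_nil addr0 normc_cexp -expR0 ler_expR.
  have -> : complex.Re (- (q * t%:C)) = - (complex.Re q * t).
    by case: (q) => a b /=; rewrite mulr0 subr0.
  by rewrite oppr_le0 mulr_ge0.
case/andP => zzs uzs hz.
have [z_q z0] := hz z (mem_head _ _).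
have [//||s /allP ss hs] := ih.
  by move=> y yzs; apply: hz; rewrite inE yzs orbT.
have hS : forall t, 0 <= t -> normc (expsum ((1, q) :: s) t) <=
    \prod_(z <- zs) (normc (z - q) / complex.Re z).
  by move=> t t0; rewrite /expsum big_cons mul1r; exact: hs.
have aS : all (fun p => p.2 != z) ((1, q) :: s).
  rewrite /= eq_sym z_q; apply/allP => p /ss pzs.
  by apply: contraNneq zzs => <-.
have zq0 : z - q != 0 by rewrite subr_eq0.
(* This is the solution P: an exponent p of the old sum gets its coefficient multiplied by (z - q) /
   (z - p), so that e^(- q t) keeps coefficient 1, and the coefficient of e^(- z t) makes P(0) =
   0. *)
exists ((- (z - q) * \sum_(p <- (1, q) :: s) p.1 / (z - p.2), z) ::
   [seq ((z - q) * (p.1 / (z - p.2)), p.2) | p <- s]).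
  rewrite /= mem_head /=; apply/allP => _ /mapP[p /ss pzs ->] /=.
  by rewrite inE pzs orbT.
move=> t t0; have hP := normc_expsum_primitive z0 aS hS t0.
rewrite big_cons.
set X := _ + _.
have -> : X = (z - q) * \sum_(p <- (1, q) :: s) p.1 / (z - p.2) *
            (cexp (- (p.2 * t%:C)) - cexp (- (z * t%:C))).
  rewrite /X /expsum !big_cons big_map /=.
  have -> : \sum_(p <- s) p.1 / (z - p.2) * (cexp (- (p.2 * t%:C)) - cexp (- (z * t%:C))) =
     \sum_(p <- s) p.1 / (z - p.2) * cexp (- (p.2 * t%:C)) -
     (\sum_(p <- s) p.1 / (z - p.2)) * cexp (- (z * t%:C)).
    rewrite mulr_suml -sumrB; apply: eq_bigr => p _; exact: mulrBr.
  have -> : \sum_(p <- s) (z - q) * (p.1 / (z - p.2)) * cexp (- (p.2 * t%:C)) =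
    (z - q) * \sum_(p <- s) p.1 / (z - p.2) * cexp (- (p.2 * t%:C)).
    by rewrite mulr_sumr; apply: eq_bigr => p _; exact/esym/mulrA.
  move: (\sum_(p <- s) _) (\sum_(p <- s) _) (cexp _) (cexp _) => A B Eq Ez.
  by move: (z) (q) zq0 => z1 q1 zq1; field.
rewrite normcM mulrAC -mulrA; apply: ler_wpM2l; first exact: normc_ge0.
exact: hP.
Qed.

(** As [Phi] vanishes on [zs], its functional takes the value Phi q on e^(- q t) plus any
    combination of the e^(- z t), z in [zs]; take the Müntz approximant. Shifting all exponents by M
    turns the weighted norm into the sup norm. *)
Lemma exp_bounded_zeros (Phi : R[i] -> R[i]) (M : R) : exp_bounded Phi ->
  exists2 K : R, 0 <= K & forall q zs, 0 <= complex.Re q + M -> uniq zs ->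
    {in zs, forall z, [/\ z != q, 0 < complex.Re z + M & Phi z = 0]} ->
    normc (Phi q) <= K * \prod_(z <- zs) (normc (z - q) / (complex.Re z + M)).
Proof.
move=> /(_ M)[K K0 hK]; exists K => // q zs qM uzs hzs.
have ReD z : complex.Re (z + M%:C) = complex.Re z + M by case: z.
have [||y /mapP[z /hzs[zq z0 _] ->]|s /allP ss hs] :=
    @muentz_approx (q + M%:C) [seq z + M%:C | z <- zs].
- by rewrite ReD.
- by rewrite map_inj_uniq // => x y /addIr.
- by rewrite ReD (inj_eq (addIr _)).
pose s0 := (1, q) :: [seq (p.1, p.2 - M%:C) | p <- s].
have -> : Phi q = evalsum Phi s0.
  rewrite /evalsum big_cons mul1r big_map big_seq big1 ?addr0 // => p /ss /=.
  by move=> /mapP[z /hzs[_ _ z0] ->]; rewrite addrK z0 mulr0.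
apply: hK => t /[dup] t0 /hs; rewrite big_map.
under eq_bigr do rewrite opprD addrACA subrr addr0 ReD.
have -> : expsum s0 t = cexp ((M * t)%:C) * (cexp (- ((q + M%:C) * t%:C)) + expsum s t).
  rewrite /expsum big_cons big_map mulrDr mulr_sumr mul1r /=.
  congr (_ + _).
    rewrite -cexpD; congr cexp; rewrite rmorphM /=.
    by rewrite mulrDl opprD addrCA subrr addr0.
  apply: eq_bigr => p _; rewrite [RHS]mulrCA -cexpD; congr (_ * cexp _).
  by rewrite rmorphM /= mulrBl opprB.
move=> h; rewrite normcM normc_cexp /= mulrC.
by apply: ler_wpM2r => //; exact: expR_ge0.
Qed.

(** Each factor satisfies F x <= 1 - G x <= e^(- G x). *)
Lemma prod_le_expR_sum (T : eqType) (r : seq T) (F G : T -> R) :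
  {in r, forall x, 0 <= F x <= 1 - G x} ->
  \prod_(x <- r) F x <= expR (- \sum_(x <- r) G x).
Proof.
elim: r => [|x r ih] h; first by rewrite !big_nil oppr0 expR0.
have /andP[F0 F1] := h x (mem_head _ _).
rewrite !big_cons opprD expRD; apply: ler_pM => //.
- rewrite big_seq; apply: prodr_ge0 => y yr.
  by have /andP[] := h y (mem_behead (s := x :: r) yr).
- by apply: le_trans F1 (expR_ge1Dx _).
- by apply: ih => y yr; apply: h; rewrite inE yr orbT.
Qed.

(** A Blaschke type condition: if Phi q is nonzero, the product over the zeros cannot be small, so
    the sum S of the deficits G satisfies |Phi q| e^S <= K, and S <= e^S bounds S. *)
Lemma exp_bounded_zeros_sum (Phi : R[i] -> R[i]) (M : R) q (G : R[i] -> R) :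
  exp_bounded Phi -> Phi q != 0 -> 0 <= complex.Re q + M ->
  exists B : R, forall zs, uniq zs ->
    {in zs, forall z, [/\ Phi z = 0, 0 < complex.Re z + M &
                 normc (z - q) / (complex.Re z + M) <= 1 - G z]} ->
    \sum_(z <- zs) G z <= B.
Proof.
move=> hPhi q0 qM; have [K K0 hK] := exp_bounded_zeros M hPhi.
have p0 : 0 < normc (Phi q) by rewrite normc_gt0.
exists (K / normc (Phi q)) => zs uzs hzs.
have h : normc (Phi q) <= K * expR (- \sum_(z <- zs) G z).
  apply: le_trans (hK q zs qM uzs _) _.
    move=> z /hzs[z0 zM _]; split => //.
    by apply: contraNneq q0 => <-; rewrite z0.
  apply: ler_wpM2l => //; apply: prod_le_expR_sum => z /hzs[_ zM ->].
  by rewrite andbT divr_ge0 ?normc_ge0 // ltW.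
rewrite ler_pdivlMr //.
have := expR_ge1Dx (\sum_(z <- zs) G z).
move: h; rewrite expRN; set S := \sum_(z <- zs) G z => h hS.
have : normc (Phi q) * expR S <= K by rewrite -ler_pdivlMr ?expR_gt0.
have : S * normc (Phi q) <= expR S * normc (Phi q).
  by rewrite ler_pM2r //; lra.
by rewrite [expR S * _]mulrC; exact: le_trans.
Qed.

(** This stands in for the isolation of zeros of an analytic function. For z on the segment from 0
    to i, |z - q| <= |q| + 1 = M / 2, so each zero contributes a factor at most 1/2. *)
Lemma exp_bounded_few_zeros (Phi : R[i] -> R[i]) q : exp_bounded Phi ->
  Phi q != 0 -> exists N : nat, forall r : seq R, uniq r ->
    {in r, forall x, 0 <= x <= 1 /\ Phi (0 +i* x) = 0} -> (size r <= N)%N.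
Proof.
move=> hPhi q0; set M := 2 * (normc q + 1).
have nq : 0 <= normc q := normc_ge0 q.
have M0 : 0 < M by rewrite mulr_gt0 // ltr_wpDl.
have qM : 0 <= complex.Re q + M.
  by have := norm_Re_le q; rewrite ler_norml /M => /andP[]; lra.
have [B hB] := exp_bounded_zeros_sum (fun=> 2^-1) hPhi q0 qM.
exists (Num.bound `|2 * B|) => r ur hr.
have := hB [seq 0 +i* x | x <- r].
rewrite big_map big_const_seq count_predT iter_addr_0 => h.
have : 2^-1 *+ size r <= B.
  apply: h; first by rewrite map_inj_uniq // => x y [].
  move=> _ /mapP[x /hr[/andP[x0 x1] hx] ->]; split => //=; first by rewrite add0r.
  rewrite add0r ler_pdivrMr //.
  apply: le_trans (le_normcD _ _) _; rewrite normcN.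
  have := normc_le_ReIm (0 +i* x); rewrite /= normr0 add0r ger0_norm // /M; lra.
rewrite -(mulr_natl _ (size r)) => h2.
rewrite -(ler_nat R); apply: le_trans (_ : _ <= 2 * B) (ltW _).
  lra.
apply: le_lt_trans (ler_norm _) _.
by apply: archi_boundP.
Qed.

(** There are no zero divisors: if the product vanished everywhere, then among N1 + N2 + 1 points of
    the segment from 0 to i, either [Phi] would have more than N1 zeros or [Psi] more than N2. *)
Lemma exp_bounded_mul_neq0 (Phi Psi : R[i] -> R[i]) q q' :
  exp_bounded Phi -> exp_bounded Psi -> Phi q != 0 -> Psi q' != 0 ->
  exists z, Phi z * Psi z != 0.
Proof.
move=> hPhi hPsi q0 q'0; apply: contrapT => /forallNP h.
have [N1 h1] := exp_bounded_few_zeros hPhi q0.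
have [N2 h2] := exp_bounded_few_zeros hPsi q'0.
pose r : seq R := [seq k.+1%:R^-1 | k <- iota 0 (N1 + N2).+1].
have ur : uniq r.
  rewrite map_inj_uniq ?iota_uniq // => j k /invr_inj /eqP.
  by rewrite eqr_nat eqSS => /eqP.
have r01 x : x \in r -> 0 <= x <= 1.
  move=> /mapP[k _ ->]; rewrite invr_ge0 ler0n /= invf_le1 ?ltr0n //.
  by rewrite ler1n.
pose a x := Phi (0 +i* x) == 0.
have s1 : (size (seq.filter a r) <= N1)%N.
  apply: h1; first exact: filter_uniq.
  by move=> x; rewrite mem_filter => /andP[/eqP ax /r01].
have s2 : (size (seq.filter (predC a) r) <= N2)%N.
  apply: h2; first exact: filter_uniq.
  move=> x; rewrite mem_filter => /andP[ax /r01 x01]; split=> //.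
  have /negP := h (0 +i* x); rewrite negbK mulf_eq0 => /orP[|/eqP//].
  by rewrite (negbTE (ax : Phi _ != 0)).
have : (size r <= N1 + N2)%N.
  by rewrite -(count_predC a r) -!size_filter leq_add.
by rewrite size_map size_iota ltnn.
Qed.

(** With M = |q| + 1, |c u_n - q| <= c u_n + M - 1, so the zero c u_n has deficit 1 / (c u_n + M).
    If Phi q were nonzero these deficits would have bounded sums, and so would the 1 / u_n. *)
Lemma exp_bounded_eq0_of_harmonic (Phi : R[i] -> R[i]) (u : nat -> R) (c : R) :
  injective u -> (forall n, 0 <= u n) -> 0 < c ->
  (\sum_(0 <= j <oo | (u j != 0)%R) ((u j)^-1)%:E = +oo)%E ->
  exp_bounded Phi -> (forall n, Phi ((c * u n)%:C) = 0) ->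
  forall q, Phi q = 0.
Proof.
move=> uI u0 c0 hsum hPhi hz q; apply: contrapT => /eqP q0.
set M := normc q + 1.
have nq : 0 <= normc q := normc_ge0 q.
have qM : 0 <= complex.Re q + M.
  by have := norm_Re_le q; rewrite ler_norml /M => /andP[]; lra.
have M0 : 0 < M by rewrite /M; lra.
have cu0 n : 0 <= c * u n by rewrite mulr_ge0 // ltW.
have [B hB] := exp_bounded_zeros_sum (fun z => (complex.Re z + M)^-1) hPhi q0 qM.
pose a n := (c * u n + M)^-1.
have a0 n : 0 < a n by rewrite invr_gt0 ltr_wpDl.
have d0 n : 0 < c * u n + M by rewrite ltr_wpDl.
pose S n := \sum_(0 <= j < n) a j.
have SB n : S n <= B.
  have := hB [seq (c * u j)%:C | j <- iota 0 n].
  rewrite big_map /S /index_iota subn0 /=; apply.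
    rewrite map_inj_uniq ?iota_uniq // => j k /complexI /(mulfI _) => /(_ _) /uI.
    by apply; rewrite gt_eqF.
  move=> _ /mapP[j _ ->]; split => //=.
  rewrite ler_pdivrMr // mulrBl mul1r mulVf ?gt_eqF //.
  apply: le_trans (le_normcD _ _) _; rewrite normcN normc_real ger0_norm //.
  by rewrite /M; lra.
pose E := [set S n | n in [set: nat]].
have supE : has_sup E.
  by split; [exists (S 0%N); exists 0%N|exists B => _ [n _ <-]].
(* An index with u_n <= 1 contributes at least 1 / (c + M). The sums beyond some N stay below this,
   so u_n > 1 from N on, where 1 / u_n <= (c + M) a_n. *)
have e0 : 0 < (c + M)^-1 by rewrite invr_gt0 addr_gt0.
have [_ [N _ <-] hN] := sup_adherent e0 supE.
have big n : (N <= n)%N -> 1 < u n.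
  move=> Nn; rewrite ltNge; apply/negP => un.
  have : S n.+1 <= sup E by apply: sup_upper_bound => //; exists n.+1.
  rewrite {1}/S (big_cat_nat (leq0n N) (leqW Nn)) /= -/(S N) big_nat_recr //=.
  have : 0 <= \sum_(N <= i < n) a i by apply: sumr_ge0 => i _; exact: ltW.
  have : (c + M)^-1 <= a n.
    rewrite /a lef_pV2 ?posrE ?(addr_gt0 c0 M0) ?d0 //.
    rewrite lerD2r; apply: ler_piMr => //; exact: ltW.
  lra.
have bnd n : \sum_(N <= j < n) (u j)^-1 <= (c + M) * (B + `|S N|).
  apply: le_trans (_ : \sum_(N <= j < n) (c + M) * a j <= _).
    rewrite big_nat_cond [leRHS]big_nat_cond; apply: ler_sum => j.
    move=> /andP[/andP[/big u1 _] _].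
    have uj0 : 0 < u j by lra.
    rewrite -ler_pdivrMl ?(addr_gt0 c0 M0) // -invfM /a.
    rewrite lef_pV2 ?posrE ?d0 ?mulr_gt0 ?(addr_gt0 c0 M0) //.
    by rewrite mulrDl lerD2l; apply: ler_peMr; lra.
  rewrite -mulr_sumr; apply: ler_wpM2l; first by rewrite addr_ge0 ?ltW.
  have [nN|Nn] := leqP n N.
    by rewrite big_geq // addr_ge0 // (le_trans _ (SB 0%N)) // /S big_geq.
  have := SB n; rewrite /S (big_cat_nat (leq0n N) (ltnW Nn)) /= -/(S N).
  have := ler_norm (- S N); rewrite normrN; lra.
have : (\sum_(0 <= j <oo | (u j != 0)%R) ((u j)^-1)%:E <=
   (\sum_(0 <= j < N) (u j)^-1 + (c + M) * (B + `|S N|))%:E)%E.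
  apply: lime_le.
    by apply: is_cvg_nneseries_cond => n _ _; rewrite lee_fin invr_ge0.
  apply: nearW => n; rewrite sumEFin lee_fin.
  apply: le_trans (_ : \sum_(0 <= j < n) (u j)^-1 <= _).
    by rewrite big_mkcond /=; apply: ler_sum => j _; case: ifP => // _; rewrite invr_ge0.
  have [nN|Nn] := leqP N n.
    by rewrite (big_cat_nat (leq0n N) nN) /= lerD2l.
  rewrite [X in _ <= X + _](big_cat_nat (leq0n n) (ltnW Nn)) /= -addrA lerDl.
  apply: addr_ge0; first by apply: sumr_ge0 => j _; rewrite invr_ge0.
  by rewrite (le_trans _ (bnd 0%N)) // big_geq.
by rewrite hsum leye_eq.
Qed.

End Uniqueness.

(** * Phase retrieval for [exp_bounded] functions *)

Section AbstractPhaseRetrieval.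
Set Implicit Arguments.
Unset Strict Implicit.
Unset Printing Implicit Defensive.
Import ComplexField.Normc.
Local Open Scope complex_scope.
Variable R : realType.
Implicit Types (F H : R[i] -> R[i]).

(** If no positive element is below e, distinct elements are at least e apart, and division with
    remainder by a least positive element shows that the subgroup is cyclic. *)
Lemma additive_subgroup_dichotomy (T : set R) :
  T 0 -> (forall x y, T x -> T y -> T (x + y)) -> (forall x, T x -> T (- x)) ->
  (exists a, forall x, T x -> exists k : int, x = a * k%:~R) \/
  (forall e, 0 < e -> exists2 x, T x & 0 < x < e).
Proof.
move=> T0 TD TN; have [small|] := pselect (forall e, 0 < e -> exists2 x, T x & 0 < x < e).
  by right.
move=> /existsNP[e] /not_implyP[e0 hsmall]; left.
have TB x y : T x -> T y -> T (x - y) by move=> Tx Ty; exact/TD/TN.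
have TMn x (n : nat) : T x -> T (x * n%:R).
  move=> Tx; elim: n => [|n ih]; first by rewrite mulr0.
  by rewrite -natr1 mulrDr mulr1; exact: TD.
have TMz x (k : int) : T x -> T (x * k%:~R).
  case: k => n Tx; first exact: TMn.
  by rewrite NegzE rmorphN mulrN; exact/TN/TMn.
have big x : T x -> 0 < x -> e <= x.
  move=> Tx x0; rewrite leNgt; apply/negP => xe.
  by apply: hsmall; exists x => //; rewrite x0.
have [[x0 Tx0 px0]|npos] := pselect (exists2 x, T x & 0 < x); last first.
  exists 0 => x Tx; exists 0; rewrite mul0r.
  have [xlt|xgt|//] := ltgtP x 0; case: npos.
    by exists (- x); [exact: TN|rewrite oppr_gt0].
  by exists x.
pose P := T `&` [set x | 0 < x].
have infP : has_inf P.
  by split; [exists x0|exists e => x [Tx px]; exact: big].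
(* An element a with a < inf P + e suffices: a remainder r in (0, a) would have a - r >= e, hence r
   < inf P. *)
have [a [Ta a0] hae] := inf_adherent e0 infP.
exists a => x Tx.
pose r := x - a * (Num.floor (x / a))%:~R.
have Tr : T r by apply: TB => //; exact: TMz.
have ane : a != 0 by rewrite gt_eqF.
have r0 : 0 <= r.
  by rewrite subr_ge0 mulrC -ler_pdivlMr // floor_le_tmp.
have ra : r < a.
  have := floorD1_gt (x / a).
  by rewrite ltr_pdivrMr // intrD mulrDl mul1r mulrC /r ltrBlDl.
exists (Num.floor (x / a)); apply/eqP; rewrite -subr_eq0 -/r.
apply: contrapT => /negP rn0.
have {}r0 : 0 < r by rewrite lt_neqAle eq_sym rn0.
have : inf P <= r by apply: inf_lbound; [exact: infP.2|split].
have : e <= a - r by apply: big; [exact: TB|rewrite subr_gt0].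
lra.
Qed.

Lemma mulc_conj (z : R[i]) : z * z^* = (normc z ^+ 2)%:C.
Proof. by rewrite -sqr_normc norm_normc rmorphXn. Qed.

Lemma phase_retrieval_exp_bounded F H (Lambda : set R) (u : nat -> R) (c : R) :
  (~ exists a b : R, Lambda `<=` arith_prog a b) ->
  injective u -> (forall n, 0 <= u n) -> 0 < c ->
  (\sum_(0 <= j <oo | (u j != 0)%R) ((u j)^-1)%:E = +oo)%E ->
  exp_bounded F -> exp_bounded H ->
  (forall n l, Lambda l ->
     normc (F ((c * u n) +i* (c * l))) = normc (H ((c * u n) +i* (c * l)))) ->
  exists2 tau, normc tau = 1 & forall z, F z = tau * H z.
Proof.
move=> hL uI u0 c0 hsum hF hH heq.
have harm Phi := exp_bounded_eq0_of_harmonic uI u0 c0 hsum (Phi := Phi).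
have [l0 Ll0] : exists l, Lambda l.
  apply: contrapT => /forallNP h; apply: hL; exists 0, 0 => l /h [].
(* The Müntz argument on the line of imaginary part c l, moved to the real axis. *)
have line_eq0 Phi l : exp_bounded Phi ->
    (forall n, Phi ((c * u n) +i* (c * l)) = 0) -> forall z, Phi z = 0.
  move=> hPhi hz z; rewrite -(subrK (0 +i* (c * l)) z).
  apply: (harm (fun z => Phi (z + (0 +i* (c * l))))) => [|n].
    exact: exp_bounded_shift.
  by rewrite -[RHS](hz n); congr Phi; apply/eqP; rewrite eq_complex /= addr0 add0r !eqxx.
(* If one of F, H is identically zero, so is the other: its values at the sampling points of one
   line vanish. Then tau = 1 will do. *)
have [H0|/existsNP[zH /eqP HzH]] := pselect (forall z, H z = 0).
  exists 1; first exact: normc1.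
  move=> z; rewrite H0 mulr0; apply: (line_eq0 F l0) => // n.
  by apply: eq0_normc; rewrite heq // H0 normc0.
have [F0|/existsNP[zF /eqP FzF]] := pselect (forall z, F z = 0).
  case/eqP: HzH; apply: (line_eq0 H l0) => // n.
  by apply: eq0_normc; rewrite -heq // F0 normc0.
pose P z := (F z^*)^*; pose Q z := (H z^*)^*.
have hP : exp_bounded P := exp_bounded_conj hF.
have hQ : exp_bounded Q := exp_bounded_conj hH.
have QzH : Q zH^* != 0 by rewrite /Q conjcK conjc_eq0.
have key l w : Lambda l ->
    F w * P (w - (0 +i* (2 * (c * l)))) = H w * Q (w - (0 +i* (2 * (c * l)))).
  move=> Ll; apply/eqP; rewrite -subr_eq0; apply/eqP.
  pose i2 := 0 +i* (2 * (c * l)).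
  apply: (line_eq0 (fun w => F w * P (w - i2) - H w * Q (w - i2)) l) => [|n].
    apply: exp_bounded_sub; apply: exp_bounded_mul => //;
      exact: (exp_bounded_shift (- i2)).
  (* At a sampling point z, subtracting 2 i c l yields the conjugate of z, and the two products
     become |F z|^2 and |H z|^2. *)
  set z := Complex _ _.
  have -> : z - i2 = z^*.
    by apply/eqP; rewrite eq_complex /= oppr0 addr0 eqxx /=; apply/eqP; ring.
  by rewrite /P /Q conjcK !mulc_conj heq // subrr.
(* The x for which i x is a period of P / Q, with denominators cleared so that zeros of P and Q do
   no harm. *)
pose T : set R := [set x | forall v, P v * Q (v + (0 +i* x)) = Q v * P (v + (0 +i* x))].
have iD x y : (0 +i* (x + y)) = (0 +i* x) + (0 +i* y) :> R[i].
  by apply/eqP; rewrite eq_complex /= addr0 !eqxx.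
have iN x : (0 +i* (- x)) = - (0 +i* x) :> R[i].
  by apply/eqP; rewrite eq_complex /= oppr0 !eqxx.
have T0 : T 0.
  by move=> v; rewrite (_ : 0 +i* 0 = 0 :> R[i]) // addr0 mulrC.
have TN x : T x -> T (- x).
  by move=> Tx v; have := Tx (v - (0 +i* x)); rewrite subrK iN => e; rewrite mulrC -e; exact: mulrC.
(* Composing the two periods produces a common factor Q (v + i x), which can be cancelled because Q
   is not identically zero and there are no zero divisors. *)
have TD x y : T x -> T y -> T (x + y).
  move=> Tx Ty v; rewrite iD addrA; apply/eqP; rewrite -subr_eq0; apply/eqP.
  apply: contrapT => /eqP nz.
  pose G v := P v * Q (v + (0 +i* x) + (0 +i* y)) - Q v * P (v + (0 +i* x) + (0 +i* y)).
  have hG : exp_bounded G.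
    rewrite /G; under eq_fun do rewrite -!addrA.
    by apply: exp_bounded_sub; apply: exp_bounded_mul => //; exact: exp_bounded_shift.
  have hQx : exp_bounded (fun v => Q (v + (0 +i* x))) by exact: exp_bounded_shift.
  have [|w] := exp_bounded_mul_neq0 (q' := zH^* - (0 +i* x)) hG hQx (nz : G v != 0) _.
    by rewrite subrK.
  have := Tx w; have := Ty (w + (0 +i* x)); rewrite /G.
  set p1 := P (w + _); set q1 := Q (w + _); set p2 := P (_ + _); set q2 := Q (_ + _).
  move=> e1 e2 /eqP; apply.
  rewrite mulrBl [P w * _ * _]mulrAC e2 -[Q w * p1 * q2]mulrA e1.
  by rewrite mulrA [Q w * q1 * p2]mulrAC subrr.
(* Both [key] identities at the same w compare P / Q at w - 2 i c l and at w - 2 i c l', points that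
   differ by i x; the factor F w H w is cancelled as before. *)
have T4 l l' : Lambda l -> Lambda l' -> T (2 * c * l - 2 * c * l').
  move=> Ll Ll' v; apply/eqP; rewrite -subr_eq0; apply/eqP.
  apply: contrapT => /eqP nz.
  pose x := 2 * c * l - 2 * c * l'.
  pose G v := P v * Q (v + (0 +i* x)) - Q v * P (v + (0 +i* x)).
  have hG : exp_bounded G.
    by apply: exp_bounded_sub; apply: exp_bounded_mul => //; exact: exp_bounded_shift.
  have [z1 hz1] := exp_bounded_mul_neq0 hF hH FzF HzH.
  pose i2 := 0 +i* (2 * (c * l)) : R[i].
  have hGs : exp_bounded (fun w => G (w - i2)) by exact: (exp_bounded_shift (- i2)).
  have [|w] := exp_bounded_mul_neq0 (q' := v + i2) (exp_bounded_mul hF hH) hGs hz1 _.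
    by rewrite addrK.
  have := key l w Ll; have := key l' w Ll'; rewrite -/i2 /G.
  have -> : w - (0 +i* (2 * (c * l'))) = w - i2 + (0 +i* x).
    rewrite -addrA -!iN -iD; congr (_ + Complex _ _); rewrite /x; ring.
  set p1 := P (w - _); set q1 := Q (w - _); set p2 := P (_ + _); set q2 := Q (_ + _).
  move=> e2 e1 /eqP; apply.
  rewrite mulrBr mulrACA e1 [F w * H w]mulrC [H w * F w * _]mulrACA.
  by rewrite e2 subrr.
have PQ v w : P v * Q w = Q v * P w.
  have [[a ha]|small] := additive_subgroup_dichotomy T0 TD TN.
    (* A cyclic group of periods would put all 2 c (l - l0) in a Z, hence [Lambda] in an arithmetic
       progression. *)
    case: hL; exists (a / (2 * c)), l0 => l Ll.
    have [k hk] := ha _ (T4 _ _ Ll Ll0).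
    exists k => //; rewrite mulrAC -hk -mulrBr mulrC mulKf ?subrK //.
    by rewrite mulf_neq0 ?gt_eqF ?pnatr_eq0.
  apply/eqP; rewrite -subr_eq0; apply/eqP; apply: contrapT => /eqP nz.
  (* [G] vanishes at i x for every period x. A positive period x < 1 / (N + 1) has N + 1 distinct
     multiples k x in [0, 1], k = 0, ..., N, one more than [G] can vanish at. *)
  pose G z := P v * Q (z + v) - Q v * P (z + v).
  have hG : exp_bounded G.
    by apply: exp_bounded_sub; apply: exp_bounded_scale; exact: exp_bounded_shift.
  have [|N hN] := exp_bounded_few_zeros (q := w - v) hG _.
    by rewrite /G subrK.
  have [|x Tx /andP[x0 xN]] := small (N.+1%:R^-1); first by rewrite invr_gt0 ltr0n.
  have TMn (n : nat) : T (n%:R * x).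
    elim: n => [|n ih]; first by rewrite mul0r.
    by rewrite -natr1 mulrDl mul1r; exact: TD.
  have := hN [seq k%:R * x | k <- iota 0 N.+1].
  rewrite size_map size_iota ltnn => h; suff : false by [].
  apply: h.
    rewrite map_inj_uniq ?iota_uniq // => j k /(mulIf _) => /(_ _)/eqP.
    by rewrite eqr_nat => h; apply/eqP/h; rewrite gt_eqF.
  move=> y /mapP[k]; rewrite mem_iota add0n => /andP[_ kN] ->; split.
    rewrite mulr_ge0 ?ler0n ?(ltW x0) //=.
    apply: le_trans (_ : N.+1%:R * N.+1%:R^-1 <= 1); last by rewrite divff.
    by apply: ler_pM; rewrite ?ler0n ?(ltW x0) ?(ltW xN) // ler_nat ltnW.
  by rewrite /G [_ + v]addrC (TMn k v) subrr.
have FH v w : F v * H w = H v * F w.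
  have := PQ v^* w^*; rewrite /P /Q !conjcK -!rmorphM => /(can_inj (@conjcK R)).
  by [].
exists (F zH / H zH); last first.
  by move=> z; apply: (mulfI HzH); rewrite -FH mulrA mulrCA divff // mulr1.
(* At some sampling point H is nonzero, as otherwise H would vanish identically. There |F| = |H|,
   which forces |tau| = 1. *)
have [n hn] : exists n, H ((c * u n) +i* (c * l0)) != 0.
  apply: contrapT => /forallNP h; case/eqP: HzH; apply: (line_eq0 H l0) => // n.
  by apply/eqP/negPn/negP; exact: h.
set zn := Complex _ _ in hn; have := heq n l0 Ll0; rewrite -/zn => e.
have n0 : normc (H zn) != 0 by rewrite normc_eq0.
have nH : normc (H zH) != 0 by rewrite normc_eq0.
rewrite normcM normcV; apply: (mulIf nH); rewrite divfK // mul1r.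
by apply: (mulIf n0); rewrite -normcM FH normcM e.
Qed.

End AbstractPhaseRetrieval.

(** * Complex integrals and the Laplace transform *)

Section LaplaceTransform.
Set Implicit Arguments.
Unset Strict Implicit.
Unset Printing Implicit Defensive.
Import ComplexField.Normc.
Local Open Scope complex_scope.
Variable R : realType.
Implicit Types (f g : R -> R[i]) (c z : R[i]) (t : R).
Local Notation mu := (@lebesgue_measure R).

Definition rintegrable (r : R -> R) := mu.-integrable [set: R] (EFin \o r).

Lemma rintegrableD (r1 r2 : R -> R) : rintegrable r1 -> rintegrable r2 ->
  rintegrable (fun t => r1 t + r2 t).
Proof. by move=> h1 h2; exact: (integrableD measurableT h1 h2). Qed.

Lemma rintegrableZ (k : R) (r : R -> R) : rintegrable r ->
  rintegrable (fun t => k * r t).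
Proof. by move=> h; exact: (integrableZl measurableT k h). Qed.

Lemma le_rintegrable (r1 r2 : R -> R) : measurable_fun [set: R] r1 ->
  (forall t, `|r1 t| <= r2 t) -> rintegrable r2 -> rintegrable r1.
Proof.
move=> m1 h12 h2; apply: (le_integrable measurableT _ _ h2).
  exact/measurable_EFinP.
by move=> t _ /=; rewrite lee_fin (le_trans (h12 t)) // ler_norm.
Qed.

Definition cmeasurable f := measurable_fun [set: R] (fun t => complex.Re (f t)) /\
  measurable_fun [set: R] (fun t => complex.Im (f t)).

Lemma cmeasurableM f g : cmeasurable f -> cmeasurable g ->
  cmeasurable (fun t => f t * g t).
Proof.
move=> [mfr mfi] [mgr mgi]; split.
  have -> : (fun t => complex.Re (f t * g t)) =
     (fun t => complex.Re (f t) * complex.Re (g t) - complex.Im (f t) * complex.Im (g t)).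
    by apply/funext => t; case: (f t) (g t) => a b [].
  by apply: measurable_funB; apply: measurable_funM.
have -> : (fun t => complex.Im (f t * g t)) =
   (fun t => complex.Re (f t) * complex.Im (g t) + complex.Im (f t) * complex.Re (g t)).
  by apply/funext => t; case: (f t) (g t) => a b [].
by apply: measurable_funD; apply: measurable_funM.
Qed.

Lemma cmeasurable_real (r : R -> R) : measurable_fun [set: R] r ->
  cmeasurable (fun t => (r t)%:C).
Proof. by move=> mr; split => //=; exact: measurable_cst. Qed.

Lemma measurable_mulr_lin (k : R) : measurable_fun [set: R] (fun t => k * t).
Proof. exact: mulrl_measurable. Qed.

Lemma cmeasurable_expi (k : R) : cmeasurable (fun t => expi (k * t)).
Proof.
split; rewrite /expi /=.
  apply: (measurableT_comp (f := @cos R)); last exact: measurable_mulr_lin.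
  apply: continuous_measurable_fun; exact: continuous_cos.
apply: (measurableT_comp (f := @sin R)); last exact: measurable_mulr_lin.
apply: continuous_measurable_fun; exact: continuous_sin.
Qed.

Lemma cexpN_real z t : cexp (- (z * t%:C)) =
  (expR (- complex.Re z * t))%:C * expi (- complex.Im z * t).
Proof.
case: z => x y; rewrite /cexp /=; congr ((expR _)%:C * expi _).
  by rewrite mulr0 subr0 mulNr.
by rewrite mulr0 add0r mulNr.
Qed.

Lemma cmeasurable_cexp z : cmeasurable (fun t => cexp (- (z * t%:C))).
Proof.
under eq_fun do rewrite cexpN_real.
apply: cmeasurableM; last exact: cmeasurable_expi.
apply: cmeasurable_real.
apply: (measurableT_comp (f := @expR R)); last exact: measurable_mulr_lin.
exact: measurable_expR.
Qed.

Definition cintegrable f := rintegrable (fun t => complex.Re (f t)) /\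
  rintegrable (fun t => complex.Im (f t)).

Lemma le_cintegrable f (r : R -> R) : cmeasurable f ->
  (forall t, normc (f t) <= r t) -> rintegrable r -> cintegrable f.
Proof.
move=> [mr mi] h hr; split; apply: (le_rintegrable _ _ hr) => // t.
  exact: le_trans (norm_Re_le _) (h t).
exact: le_trans (norm_Im_le _) (h t).
Qed.

Lemma cintegrableD f g : cintegrable f -> cintegrable g ->
  cintegrable (fun t => f t + g t).
Proof.
move=> [fr fi] [gr gi]; split.
  by under eq_fun do rewrite raddfD /=; exact: rintegrableD.
by under eq_fun do rewrite raddfD /=; exact: rintegrableD.
Qed.

Lemma CintegralD f g : cintegrable f -> cintegrable g ->
  Cintegral (fun t => f t + g t) = Cintegral f + Cintegral g.
Proof.
move=> [fr fi] [gr gi]; rewrite /Cintegral.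
under eq_Rintegral do rewrite raddfD /=.
under [X in _ +i* X]eq_Rintegral do rewrite raddfD /=.
by rewrite !RintegralD.
Qed.

Lemma cintegrableZ c f : cintegrable f -> cintegrable (fun t => c * f t).
Proof.
case: c => a b [fr fi]; split.
  have -> : (fun t => complex.Re ((a +i* b) * f t)) =
     (fun t => a * complex.Re (f t) + - b * complex.Im (f t)).
    by apply/funext => t; case: (f t) => x y /=; rewrite mulNr.
  by apply: rintegrableD; exact: rintegrableZ.
have -> : (fun t => complex.Im ((a +i* b) * f t)) =
     (fun t => a * complex.Im (f t) + b * complex.Re (f t)).
  by apply/funext => t; case: (f t) => x y.
by apply: rintegrableD; exact: rintegrableZ.
Qed.

Lemma CintegralZ c f : cintegrable f ->
  Cintegral (fun t => c * f t) = c * Cintegral f.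
Proof.
case: c => a b [fr fi]; rewrite /Cintegral.
have -> : (fun t => complex.Re ((a +i* b) * f t)) =
     (fun t => a * complex.Re (f t) + - b * complex.Im (f t)).
  by apply/funext => t; case: (f t) => x y /=; rewrite mulNr.
have -> : (fun t => complex.Im ((a +i* b) * f t)) =
     (fun t => a * complex.Im (f t) + b * complex.Re (f t)).
  by apply/funext => t; case: (f t) => x y.
rewrite !RintegralD //; try exact: rintegrableZ.
by rewrite !RintegralZl // mulNr.
Qed.

(** The factor 2 comes from bounding the real and imaginary parts separately; it is absorbed in the
    constant of [exp_bounded]. *)
Lemma normc_Cintegral_le f (r : R -> R) : cmeasurable f ->
  (forall t, normc (f t) <= r t) -> rintegrable r ->
  normc (Cintegral f) <= 2 * \int[mu]_(t in [set: R]) r t.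
Proof.
move=> mf h hr; have [fr fi] := le_cintegrable mf h hr.
apply: le_trans (normc_le_ReIm _) _; rewrite mulr_natl mulr2n /=.
have norm_int (s : R -> R) : rintegrable s -> rintegrable (fun t => `|s t|).
  move=> hs; apply: (integrable_norm hs).
apply: lerD.
  apply: le_trans (le_normr_Rintegral measurableT fr) _.
  apply: le_Rintegral => //; first exact: norm_int.
  by move=> t _; exact: le_trans (norm_Re_le _) (h t).
apply: le_trans (le_normr_Rintegral measurableT fi) _.
apply: le_Rintegral => //; first exact: norm_int.
by move=> t _; exact: le_trans (norm_Im_le _) (h t).
Qed.

(** All exponential moments are finite, so the Laplace integral converges for every complex z. *)
Definition rapidly_decaying g := [/\ cmeasurable g, forall t, t < 0 -> g t = 0 &
  forall M : R, rintegrable (fun t => normc (g t) * expR (M * t))].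

Definition laplace g z := Cintegral (fun t => g t * cexp (- (z * t%:C))).

Lemma laplace_cintegrable g z : rapidly_decaying g ->
  cintegrable (fun t => g t * cexp (- (z * t%:C))).
Proof.
move=> [mg g0 hg]; apply: (le_cintegrable _ _ (hg (- complex.Re z))).
  by apply: cmeasurableM => //; exact: cmeasurable_cexp.
by move=> t; rewrite normcM cexpN_real normcM normc_expi mulr1 normc_real ger0_norm ?expR_ge0.
Qed.

Lemma Cintegral_expsum g s : rapidly_decaying g ->
  cintegrable (fun t => g t * expsum s t) /\
  Cintegral (fun t => g t * expsum s t) = evalsum (laplace g) s.
Proof.
move=> hg; elim: s => [|p s [ih1 ih2]].
  have e : (fun t => g t * expsum [::] t) = (fun t => 0 * (g t * cexp (- (0 * t%:C)))).
    by apply/funext => t; rewrite /expsum big_nil mulr0 mul0r.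
  have hc := laplace_cintegrable 0 hg.
  rewrite e; split; first exact: cintegrableZ.
  by rewrite (CintegralZ _ hc) mul0r /evalsum big_nil.
have hc := laplace_cintegrable p.2 hg.
have -> : (fun t => g t * expsum (p :: s) t) =
   (fun t => p.1 * (g t * cexp (- (p.2 * t%:C))) + g t * expsum s t).
  by apply/funext => t; rewrite /expsum big_cons mulrDr mulrCA.
split; first by apply: cintegrableD => //; exact: cintegrableZ.
rewrite CintegralD //; last exact: cintegrableZ.
by rewrite CintegralZ // ih2 /evalsum big_cons.
Qed.

(** By linearity [evalsum (laplace g) s] is the integral of g times [expsum s], and |g| e^(M t) is
    integrable. *)
Lemma exp_bounded_laplace g : rapidly_decaying g -> exp_bounded (laplace g).
Proof.
move=> hg M; have [mg g0 /(_ M) hM] := hg.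
pose I := \int[mu]_(t in [set: R]) (normc (g t) * expR (M * t)).
have I0 : 0 <= I.
  by apply: Rintegral_ge0 => t _; rewrite mulr_ge0 ?normc_ge0 ?expR_ge0.
exists (2 * I); first exact: mulr_ge0.
move=> s B hB; have [[ir ii] <-] := Cintegral_expsum s hg.
rewrite -mulrA [I * B]mulrC /I -RintegralZl //.
apply: normc_Cintegral_le.
- split.
    by have /measurable_int := ir => /measurable_EFinP.
  by have /measurable_int := ii => /measurable_EFinP.
- move=> t; have [t0|t0] := leP 0 t.
    rewrite normcM mulrCA; apply: ler_wpM2l; [exact: normc_ge0|exact: hB].
  by rewrite g0 // mul0r normc0 mul0r mulr0.
- exact: rintegrableZ.
Qed.

End LaplaceTransform.

(** * Injectivity of the Laplace transform *)

Section LaplaceInjectivity.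
Set Implicit Arguments.
Unset Strict Implicit.
Unset Printing Implicit Defensive.
Import ComplexField.Normc.
Local Open Scope complex_scope.
Variable R : realType.
Local Notation mu := (@lebesgue_measure R).

Lemma ae_neq (a : R) : {ae mu, forall t, t != a}.
Proof.
exists [set a]; split; [exact: measurable_set1|exact: lebesgue_measure_set1|].
by move=> t /= /negP/negPn/eqP.
Qed.

Lemma bernoulli_ineq (x : R) n : 0 <= x <= 1 -> 1 - n%:R * x <= (1 - x) ^+ n.
Proof.
move=> /andP[x0 x1]; elim: n => [|n ih]; first by rewrite mul0r subr0.
rewrite exprS; apply: le_trans (_ : (1 - x) * (1 - n%:R * x) <= _); last first.
  by apply: ler_wpM2l; rewrite ?subr_ge0.
rewrite -natr1; have : 0 <= n%:R * x * x by rewrite !mulr_ge0.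
lra.
Qed.

(* With [x = e^(- b t)] the limit is 0 or 1 according to the sign of
   [2 x - 1], and the approximants are polynomials in [x]. *)
Lemma cvg_threshold_gt (x : R) : 0 <= x -> 2 * x < 1 ->
  (1 - x ^+ n) ^+ (2 ^ n) @[n --> \oo] --> (1 : R).
Proof.
move=> x0 x2; have x1 n : 0 <= x ^+ n <= 1.
  by rewrite exprn_ge0 //= exprn_ile1 //; lra.
(* Bernoulli's inequality bounds the power below by 1 - 2^n x^n. *)
have h : 1 - (2 * x) ^+ n @[n --> \oo] --> (1 : R).
  rewrite -[X in _ --> X]subr0; apply: cvgB; first exact: cvg_cst.
  by apply: cvg_expr; rewrite ger0_norm ?mulr_ge0.
apply: (@squeeze_cvgr _ _ _ _ (fun n => 1 - (2 * x) ^+ n) (fun=> 1)) => //; last exact: cvg_cst.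
apply: nearW => n; have /andP[xn0 xn1] := x1 n; apply/andP; split.
  by have := bernoulli_ineq (2 ^ n) (x1 n); rewrite natrX -exprMn.
by apply: exprn_ile1; lra.
Qed.

(** From 1 - y <= e^(- y) the power is at most e^(- (2 x)^n), hence at most (2 x)^(- n). *)
Lemma cvg_threshold_lt (x : R) : 0 <= x <= 1 -> 1 < 2 * x ->
  (1 - x ^+ n) ^+ (2 ^ n) @[n --> \oo] --> (0 : R).
Proof.
move=> /andP[x0 x1] x2.
have y0 : 0 < 2 * x by lra.
have h : (2 * x)^-1 ^+ n @[n --> \oo] --> (0 : R).
  by apply: cvg_expr; rewrite ger0_norm ?invr_ge0 ?(ltW y0) // invf_lt1.
apply: (@squeeze_cvgr _ _ _ _ (fun=> 0) (fun n => (2 * x)^-1 ^+ n)) => //; last exact: cvg_cst.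
apply: nearW => n.
have xn1 : x ^+ n <= 1 by rewrite exprn_ile1.
have xn0 : 0 <= x ^+ n by rewrite exprn_ge0.
rewrite exprn_ge0 ?subr_ge0 //=.
apply: le_trans (_ : expR (- x ^+ n) ^+ (2 ^ n) <= _).
  by apply: lerXn2r; rewrite ?nnegrE ?subr_ge0 ?expR_ge0 // expR_ge1Dx.
rewrite -expRM_natl natrX mulrN -exprMn expRN exprVn lef_pV2 ?posrE ?expR_gt0 ?exprn_gt0 //.
by have := expR_ge1Dx ((2 * x) ^+ n); lra.
Qed.

(** Monomials in e^(- b t) are exponentials e^(- i b t) with i b >= 0, and the hypothesis kills each
    of them. *)
Lemma Rintegral_horner_exp (r : R -> R) (b : R) (p : {poly R}) : 0 <= b ->
  rintegrable r -> (forall t, t < 0 -> r t = 0) ->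
  (forall x, 0 <= x -> \int[mu]_(t in [set: R]) (r t * expR (- x * t)) = 0) ->
  rintegrable (fun t => r t * p.[expR (- b * t)]) /\
  \int[mu]_(t in [set: R]) (r t * p.[expR (- b * t)]) = 0.
Proof.
move=> b0 hr r0 hx.
have mr : measurable_fun [set: R] r by have /measurable_int/measurable_EFinP := hr.
have hi x : 0 <= x -> rintegrable (fun t => r t * expR (- x * t)).
  move=> x0; apply: (@le_rintegrable _ _ (fun t => `|r t|)).
  - apply: measurable_funM => //.
    apply: (measurableT_comp (f := @expR R)); last exact: measurable_mulr_lin.
    exact: measurable_expR.
  - move=> t; have [t0|/r0 ->] := leP 0 t; last by rewrite mul0r normr0.
    rewrite normrM [`|expR _|]ger0_norm ?expR_ge0 //; apply: ler_piMr => //.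
    by rewrite -expR0 ler_expR mulNr oppr_le0 mulr_ge0.
  - exact: (integrable_norm hr).
suff h (q : nat -> R) n :
    rintegrable (fun t => \sum_(i < n) q i * (r t * expR (- (i%:R * b) * t))) /\
    \int[mu]_(t in [set: R]) (\sum_(i < n) q i * (r t * expR (- (i%:R * b) * t))) = 0.
  have -> : (fun t => r t * p.[expR (- b * t)]) =
      (fun t => \sum_(i < size p) p`_i * (r t * expR (- (i%:R * b) * t))).
    apply/funext => t.
    rewrite horner_coef mulr_sumr; apply: eq_bigr => i _.
    by rewrite mulrCA -expRM_natl; congr (_ * (_ * expR _)); rewrite mulNr mulrN mulNr mulrA.
  exact: h.
elim: n => [|n [ih1 ih2]].
  split; last by under eq_Rintegral do rewrite big_ord0; rewrite /Rintegral integral0.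
  under eq_fun do rewrite big_ord0; exact: integrable0.
have hn : rintegrable (fun t => q n * (r t * expR (- (n%:R * b) * t))).
  by apply/rintegrableZ/hi; rewrite mulr_ge0.
split.
  by under eq_fun do rewrite big_ord_recr /=; exact: rintegrableD.
under eq_Rintegral do rewrite big_ord_recr /=.
rewrite RintegralD // ih2 add0r RintegralZl //; last by apply: hi; rewrite mulr_ge0.
by rewrite hx ?mulr0 // mulr_ge0.
Qed.

(** With b = ln 2 / a, the threshold e^(- b t) = 1/2 is at t = a. The polynomials [p n] in e^(- b t)
    take values in [0, 1] for t >= 0 and tend to the indicator of t <= a except at a, so dominated
    convergence with bound |r| applies. *)
Lemma Rintegral_Ny_eq0 (r : R -> R) (a : R) : 0 < a ->
  rintegrable r -> (forall t, t < 0 -> r t = 0) ->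
  (forall x, 0 <= x -> \int[mu]_(t in [set: R]) (r t * expR (- x * t)) = 0) ->
  \int[mu]_(t in `]-oo, a]) r t = 0.
Proof.
move=> a0 hr r0 hx.
have mr : measurable_fun [set: R] r by have /measurable_int/measurable_EFinP := hr.
pose b := ln 2 / a.
have ln2 : 0 < ln 2 :> R by apply: ln_gt0; lra.
have b0 : 0 < b by rewrite divr_gt0.
pose p n : {poly R} := 1 - (1 - 'X^n) ^+ (2 ^ n).
pose f n t := r t * (p n).[expR (- b * t)].
have pE n x : (p n).[x] = 1 - (1 - x ^+ n) ^+ (2 ^ n).
  by rewrite /p !hornerE.
have int0 n : rintegrable (f n) /\ \int[mu]_(t in [set: R]) f n t = 0.
  by apply: Rintegral_horner_exp => //; exact: ltW.
have x01 t : 0 <= t -> 0 <= expR (- b * t) <= 1.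
  move=> t0; rewrite expR_ge0 /= -expR0 ler_expR mulNr oppr_le0.
  by rewrite mulr_ge0 // ltW.
have x2 t : 2 * expR (- b * t) = expR (b * (a - t)).
  have {1}-> : 2 = expR (ln 2) :> R by rewrite lnK // posrE.
  by rewrite -expRD; congr expR; rewrite mulrBr /b divfK ?gt_eqF // mulNr.
have cvgf t : t != a -> f n t @[n --> \oo] --> (r \_ `]-oo, a]) t.
  move=> ta; rewrite /f patchE.
  have [t0|t0] := ltP t 0.
    by rewrite r0 //; under eq_fun do rewrite mul0r; case: ifP => _; exact: cvg_cst.
  have /andP[h0 h1] := x01 t t0.
  under eq_fun do rewrite pE.
  have [tlt|tgt|/eqP] := ltgtP t a; last by rewrite (negbTE ta).
    rewrite ifT; last by rewrite inE /= in_itv /= ltW.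
    suff : r t * (1 - (1 - expR (- b * t) ^+ n) ^+ (2 ^ n)) @[n --> \oo] --> r t * (1 - 0).
      by rewrite subr0 mulr1.
    apply: cvgM; first exact: cvg_cst.
    apply: cvgB; first exact: cvg_cst.
    apply: cvg_threshold_lt; first by rewrite h0 h1.
    by rewrite x2 -expR0 ltr_expR mulr_gt0 // subr_gt0.
  rewrite ifF; last first.
    apply/negbTE; rewrite notin_setE /= in_itv /= => ta'.
    by have := lt_le_trans tgt ta'; rewrite ltxx.
  suff : r t * (1 - (1 - expR (- b * t) ^+ n) ^+ (2 ^ n)) @[n --> \oo] --> r t * (1 - 1).
    by rewrite subrr mulr0.
  apply: cvgM; first exact: cvg_cst.
  apply: cvgB; first exact: cvg_cst.
  apply: cvg_threshold_gt => //.
  by rewrite x2 -expR0 ltr_expR pmulr_rlt0 // subr_lt0.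
have mpatch : measurable_fun [set: R] (r \_ `]-oo, a]).
  by apply/(measurable_restrictT _ _).1 => //; exact: measurable_funTS.
have [||||| _ _] := @dominated_convergence _ _ R mu [set: R] measurableT
   (fun n t => (f n t)%:E) (fun t => ((r \_ `]-oo, a]) t)%:E) (fun t => `|r t|%:E).
- move=> n; apply/measurable_EFinP; apply: measurable_funM => //.
  under eq_fun do rewrite pE.
  apply: measurable_funB; first exact: measurable_cst.
  apply: measurable_funX; apply: measurable_funB; first exact: measurable_cst.
  apply: measurable_funX.
  apply: (measurableT_comp (f := @expR R)); last exact: measurable_mulr_lin.
  exact: measurable_expR.
- exact/measurable_EFinP.
- have := ae_neq a; apply: filterS; first exact: (ae_filter_ringOfSetsType mu).
  move=> t ta _; apply: cvg_EFin; first exact: nearW.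
  exact: cvgf.
- exact: (integrable_norm hr).
- apply: aeW => t n _; rewrite /= lee_fin /f normrM.
  have [t0|t0] := ltP t 0; first by rewrite r0 // normr0 mul0r.
  have /andP[h0 h1] := x01 t t0.
  apply: ler_piMr => //; rewrite pE ler_norml.
  have hn0 : 0 <= expR (- b * t) ^+ n by rewrite exprn_ge0.
  have hn1 : expR (- b * t) ^+ n <= 1 by rewrite exprn_ile1.
  have : 0 <= (1 - expR (- b * t) ^+ n) ^+ (2 ^ n) by rewrite exprn_ge0 // subr_ge0.
  have : (1 - expR (- b * t) ^+ n) ^+ (2 ^ n) <= 1 by rewrite exprn_ile1 ?subr_ge0 //; lra.
  lra.
have fin0 n : (\int[mu]_(t in [set: R]) (f n t)%:E)%E = 0%E.
  have [fi f0] := int0 n.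
  by rewrite -[LHS]fineK ?integrable_fin_num //; congr EFin.
under eq_fun do rewrite /= fin0.
move/cvg_lim; rewrite lim_cst // => h.
by rewrite Rintegral_mkcond /Rintegral -[X in fine X]h.
Qed.

(** The primitive of r vanishes on the positive axis, and almost everywhere its derivative is r. *)
Lemma ae_eq0_of_exp_moments (r : R -> R) :
  rintegrable r -> (forall t, t < 0 -> r t = 0) ->
  (forall x, 0 <= x -> \int[mu]_(t in [set: R]) (r t * expR (- x * t)) = 0) ->
  {ae mu, forall t, r t = 0}.
Proof.
move=> hr r0 hx.
have hy y : mu.-integrable `]-oo, y] (EFin \o r).
  by apply: (integrableS measurableT) => //.
have := FTC1Ny hy (open_integrable_locally openT hr).
have := ae_neq 0; apply: filterS2; first exact: (ae_filter_ringOfSetsType mu).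
move=> t t0 [_ e].
have [/r0 //|tgt|/eqP] := ltgtP t 0; last by rewrite (negbTE t0).
rewrite -e derive1E (@near_eq_derive _ _ _ _ (cst 0)) ?derive_cst //.
have := lt_nbhsr tgt; apply: filterS => a a0.
exact: Rintegral_Ny_eq0.
Qed.

(** At real arguments the kernel is real, so the real and imaginary parts of g can be treated
    separately. *)
Lemma laplace_injective (g : R -> R[i]) : rapidly_decaying g ->
  (forall z, laplace g z = 0) -> {ae mu, forall t, g t = 0}.
Proof.
move=> hg h0; have [mg g0 _] := hg.
have expE x t : cexp (- (x%:C * t%:C)) = (expR (- x * t))%:C.
  by rewrite cexpN_real /= oppr0 mul0r /expi cos0 sin0 mulr1.
have ReM x t : complex.Re (g t * cexp (- (x%:C * t%:C))) = complex.Re (g t) * expR (- x * t).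
  by rewrite expE; case: (g t) => a b /=; rewrite mulr0 subr0.
have ImM x t : complex.Im (g t * cexp (- (x%:C * t%:C))) = complex.Im (g t) * expR (- x * t).
  by rewrite expE; case: (g t) => a b /=; rewrite mulr0 add0r.
have [hr hi] : cintegrable g.
  have := laplace_cintegrable 0 hg.
  by under eq_fun do rewrite mul0r oppr0 cexp0 mulr1.
have hRe : {ae mu, forall t, complex.Re (g t) = 0}.
  apply: ae_eq0_of_exp_moments => // [t /g0 -> //|x _].
  have /eqP := h0 x%:C; rewrite eq_complex /= => /andP[/eqP + _].
  by under eq_Rintegral do rewrite ReM.
have hIm : {ae mu, forall t, complex.Im (g t) = 0}.
  apply: ae_eq0_of_exp_moments => // [t /g0 -> //|x _].
  have /eqP := h0 x%:C; rewrite eq_complex /= => /andP[_ /eqP +].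
  by under eq_Rintegral do rewrite ImM.
move: hRe hIm; apply: filterS2; first exact: (ae_filter_ringOfSetsType mu).
by move=> t; case: (g t) => a b /= -> ->.
Qed.

End LaplaceInjectivity.

(** * From the Gabor transform to the Laplace transform *)

Section GaborLaplace.
Set Implicit Arguments.
Unset Strict Implicit.
Unset Printing Implicit Defensive.
Import ComplexField.Normc.
Local Open Scope complex_scope.
Variable R : realType.
Implicit Types (f g : R -> R[i]) (t : R).
Local Notation mu := (@lebesgue_measure R).

Lemma measurable_normc f : cmeasurable f ->
  measurable_fun [set: R] (fun t => normc (f t)).
Proof.
move=> [mr mi]; have -> : (fun t => normc (f t)) =
   (@Num.sqrt R \o (fun t => complex.Re (f t) ^+ 2 + complex.Im (f t) ^+ 2)).
  by apply/funext => t /=; case: (f t).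
apply: measurableT_comp.
  by apply: continuous_measurable_fun; exact: sqrt_continuous.
by apply: measurable_funD; apply: measurable_funX.
Qed.

Lemma measurable_gaussian : measurable_fun [set: R] (@gaussian R).
Proof.
apply: (measurableT_comp (f := @expR R)); first exact: measurable_expR.
apply: (measurableT_comp (f := @GRing.opp R)); first exact: oppr_measurable.
apply: (measurableT_comp (f := *%R pi)); first exact: mulrl_measurable.
exact: measurable_funX.
Qed.

(** Members of [L2_Rplus] vanish on the negative axis only almost everywhere; the cutoff gives the
    vanishing everywhere that [rapidly_decaying] asks for. *)
Definition half_gaussian t : R := gaussian t * \1_(`[0, +oo[ : set R) t.

Lemma half_gaussian_ge0 t : 0 <= t -> half_gaussian t = gaussian t.
Proof.
by move=> t0; rewrite /half_gaussian indicE mem_set ?mulr1 //= in_itv /= t0.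
Qed.

Lemma half_gaussian_lt0 t : t < 0 -> half_gaussian t = 0.
Proof.
move=> t0; rewrite /half_gaussian indicE memNset ?mulr0 //= in_itv /= andbT.
by move=> /(lt_le_trans t0); rewrite ltxx.
Qed.

Lemma normr_half_gaussian_le t : `|half_gaussian t| <= gaussian t.
Proof.
have [t0|t0] := leP 0 t; first by rewrite half_gaussian_ge0 // ger0_norm ?expR_ge0.
by rewrite half_gaussian_lt0 // normr0 expR_ge0.
Qed.

Lemma cmeasurable_half_gaussian : cmeasurable (fun t => (half_gaussian t)%:C).
Proof.
apply: cmeasurable_real; apply: measurable_funM; first exact: measurable_gaussian.
exact: measurable_indic.
Qed.

(** From 2 M t <= M^2 + t^2 and pi >= 1; [gauss_fun] is e^(- t^2), whose integrability is known. *)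
Lemma gaussian_expR_sqr_le (M t : R) :
  (gaussian t * expR (M * t)) ^+ 2 <= expR (M ^+ 2) * gauss_fun t.
Proof.
rewrite /gaussian /gauss_fun -!expRD -expRM_natl ler_expR.
have pi1 : 1 <= pi :> R by apply: le_trans (@pi_ge2 R); lra.
have : t ^+ 2 <= pi * t ^+ 2 by apply: ler_peMl => //; exact: sqr_ge0.
have : 0 <= (t - M) ^+ 2 by exact: sqr_ge0.
rewrite !expr2; lra.
Qed.

(** The product of a = |f| and b = e^(- pi t^2 + M t) is at most a^2 + b^2, and both squares are
    integrable. *)
Lemma rapidly_decaying_half_gaussian f : L2 f ->
  rapidly_decaying (fun t => f t * (half_gaussian t)%:C).
Proof.
move=> [mr mi hf]; have mf : cmeasurable f by [].
have mg : cmeasurable (fun t => f t * (half_gaussian t)%:C).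
  by apply: cmeasurableM => //; exact: cmeasurable_half_gaussian.
split=> // [t t0|M]; first by rewrite half_gaussian_lt0 // mulr0.
have h2 : rintegrable (fun t => normc (f t) ^+ 2).
  apply/integrableP; split.
    by apply/measurable_EFinP/measurable_funX; exact: measurable_normc.
  apply: le_lt_trans hf; rewrite le_eqVlt; apply/orP; left; apply/eqP.
  by apply: eq_integral => t _ /=; rewrite ger0_norm // sqr_ge0.
have hb := rintegrableD h2 (rintegrableZ (expR (M ^+ 2)) (@integrableT_gauss R)).
apply: (le_rintegrable _ _ hb).
  apply: measurable_funM; first exact: measurable_normc.
  apply: (measurableT_comp (f := @expR R)); last exact: measurable_mulr_lin.
  exact: measurable_expR.
move=> t; rewrite ger0_norm ?mulr_ge0 ?normc_ge0 ?expR_ge0 //.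
rewrite normcM normc_real.
set a := normc (f t); set b := gaussian t * expR (M * t).
have a0 : 0 <= a := normc_ge0 _.
have b0 : 0 <= b by rewrite mulr_ge0 ?expR_ge0.
apply: le_trans (_ : a * b <= _).
  rewrite -mulrA; apply: ler_wpM2l => //; apply: ler_wpM2r; first exact: expR_ge0.
  exact: normr_half_gaussian_le.
apply: le_trans (_ : a ^+ 2 + b ^+ 2 <= _); last first.
  by rewrite lerD2l; exact: gaussian_expR_sqr_le.
have : 0 <= (a - b) ^+ 2 by exact: sqr_ge0.
have : 0 <= a * b by rewrite mulr_ge0.
rewrite !expr2; lra.
Qed.

Lemma Cintegral_ae_eq f g : cmeasurable f -> cmeasurable g ->
  {ae mu, forall t, f t = g t} -> Cintegral f = Cintegral g.
Proof.
move=> [fr fi] [gr gi] fg; rewrite /Cintegral /Rintegral; congr (fine _ +i* fine _).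
  apply: ae_eq_integral => //; try exact/measurable_EFinP.
  move: fg; apply: filterS; first exact: (ae_filter_ringOfSetsType mu).
  by move=> t -> .
apply: ae_eq_integral => //; try exact/measurable_EFinP.
move: fg; apply: filterS; first exact: (ae_filter_ringOfSetsType mu).
by move=> t -> .
Qed.

(* Completing the square: pi (t + x)^2 = pi t^2 + pi x^2 + 2 pi x t. *)
Lemma gabor_laplace f (x l : R) : L2_Rplus f ->
  gabor f (- x, l) = (gaussian x)%:C *
    laplace (fun t => f t * (half_gaussian t)%:C) ((2 * pi * x) +i* (2 * pi * l)).
Proof.
move=> [hf f0]; have [mr mi _] := hf; have mf : cmeasurable f by [].
have hg := rapidly_decaying_half_gaussian hf.
rewrite /laplace -CintegralZ; last exact: laplace_cintegrable.
rewrite /gabor /=; apply: Cintegral_ae_eq.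
- apply: cmeasurableM.
    apply: cmeasurableM => //; apply: cmeasurable_real.
    apply: (measurableT_comp (f := @gaussian R)); first exact: measurable_gaussian.
    by apply: measurable_funB => //; exact: measurable_cst.
  by under eq_fun do rewrite -mulNr; exact: cmeasurable_expi.
- apply: cmeasurableM; first by apply: cmeasurable_real; exact: measurable_cst.
  by have [[]] := laplace_cintegrable ((2 * pi * x) +i* (2 * pi * l)) hg;
    move=> /measurable_int/measurable_EFinP ? /measurable_int/measurable_EFinP.
move: f0; apply: filterS; first exact: (ae_filter_ringOfSetsType mu).
move=> t ft0; have [t0|t0] := leP 0 t; last first.
  by rewrite ft0 ?mul0r ?mulr0 //; apply/negP; rewrite -ltNge.
rewrite half_gaussian_ge0 // cexpN_real /=.
rewrite -[LHS]mulrA -[f t * _ * (_ * _)]mulrA [RHS]mulrCA; congr (f t * _).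
rewrite !mulrA -!rmorphM /=; congr (_%:C * expi _); last by rewrite mulNr.
rewrite /gaussian -!expRD; congr expR; ring.
Qed.

Lemma rapidly_decayingB f g tau : rapidly_decaying f -> rapidly_decaying g ->
  rapidly_decaying (fun t => f t - tau * g t) /\
  forall z, laplace (fun t => f t - tau * g t) z = laplace f z - tau * laplace g z.
Proof.
move=> hf hg; have [mf f0 If] := hf; have [mg g0 Ig] := hg.
have [mr mi] : cmeasurable (fun t => - tau * g t).
  by apply: cmeasurableM => //; split; exact: measurable_cst.
have eBD : (fun t => f t - tau * g t) = (fun t => f t + - tau * g t).
  by apply/funext => t; rewrite mulNr.
rewrite eBD; split.
  have mfg : cmeasurable (fun t => f t + - tau * g t).
    have [mfr mfi] := mf.
    by split; under eq_fun do rewrite raddfD /=; exact: measurable_funD.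
  split=> // [t t0|M]; first by rewrite f0 // g0 // mulr0 addr0.
  have hb := rintegrableD (If M) (rintegrableZ (normc tau) (Ig M)).
  apply: (le_rintegrable _ _ hb).
    apply: measurable_funM; first exact: measurable_normc.
    apply: (measurableT_comp (f := @expR R)); last exact: measurable_mulr_lin.
    exact: measurable_expR.
  move=> t; rewrite ger0_norm ?mulr_ge0 ?normc_ge0 ?expR_ge0 //.
  rewrite mulrA -mulrDl; apply: ler_wpM2r; first exact: expR_ge0.
  by apply: le_trans (le_normcD _ _) _; rewrite normcM normcN.
move=> z; rewrite -mulNr -CintegralZ; last exact: laplace_cintegrable.
rewrite -CintegralD; last 2 first.
- exact: laplace_cintegrable.
- by apply: cintegrableZ; exact: laplace_cintegrable.
by congr Cintegral; apply/funext => t; rewrite mulrDl -mulrA.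
Qed.

End GaborLaplace.

(** * Gabor phase retrieval on the half line *)

Theorem theorem1p3 (R : realType) (Lambda U : set R) (u : nat -> R)
  (hLambda : ~ exists a b : R, Lambda `<=` arith_prog a b)
  (hu_inj : injective u)
  (hU : U = range u)
  (hU_ge0 : U `<=` [set x | 0 <= x])
  (hsum : (\sum_(0 <= j <oo | (u j != 0)%R) ((u j)^-1)%:E = +oo)%E) :
  gabor_uniqueness_set (@L2_Rplus R) [set (- x, l) | x in U & l in Lambda].

Proof.
move=> f h hf hh heq.
have u0 n : 0 <= u n by apply: hU_ge0; rewrite hU; exists n.
have c0 : 0 < 2 * pi :> R by rewrite mulr_gt0 // pi_gt0.
pose cut f t := (f t * (half_gaussian t)%:C)%C : R[i].
have rf : rapidly_decaying (cut f) by apply: rapidly_decaying_half_gaussian hf.1.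
have rh : rapidly_decaying (cut h) by apply: rapidly_decaying_half_gaussian hh.1.
have [n l Ll|tau tau1 htau] := phase_retrieval_exp_bounded hLambda hu_inj u0 c0 hsum
    (exp_bounded_laplace rf) (exp_bounded_laplace rh).
  have /heq : [set (- x, l) | x in U & l in Lambda] (- u n, l).
    by exists (u n); [rewrite hU; exists n|exists l].
  rewrite !gabor_laplace // !norm_normc => /complexI.
  (* The Gaussian factor depends only on the sampling point, is common to f and h, and is
     nonzero. *)
  rewrite !ComplexField.Normc.normcM => /mulfI; apply.
  by rewrite normc_eq0 eq_complex /= negb_and gt_eqF // expR_gt0.
exists tau; first by rewrite norm_normc tau1.
(* F = tau H says that the Laplace transform of the cut function f - tau h is zero, so injectivity
   applies to this difference. *)
have [rB eB] := rapidly_decayingB tau rf rh.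
have hB z : laplace (fun t => cut f t - tau * cut h t) z = 0.
  by rewrite eB htau subrr.
have := laplace_injective rB hB; have := hh.2; have := hf.2.
apply: filterS3; first exact: (ae_filter_ringOfSetsType lebesgue_measure).
(* For t < 0 both functions vanish; for t >= 0 the positive Gaussian is divided out. *)
move=> t ft0 ht0; have [t0|t0] := leP 0 t; last first.
  have nt0 : ~ 0 <= t by apply/negP; rewrite -ltNge.
  by rewrite ft0 // ht0 // mulr0.
rewrite /cut half_gaussian_ge0 // mulrA -mulrBl => /eqP; rewrite mulf_eq0.
case/orP => [/eqP/subr0_eq //|].
by rewrite eq_complex /= gt_eqF ?expR_gt0.
Qed.
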